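(* For every odd integer $n\ge 7$, $$L(n)\ge 3\left(2^{n-4}-1\right).$$
   Context: A Pulse Graph is a finite directed graph $G=(V,E)$ with no self-loops (for distinct $u,v$, each of the edges $(u,v)$, $(v,u)$ may or may not be present, with no multiple edges), together with Boolean states $x_t:V\to\{0,1\}$, $t=0,1,2,\dots$. For $v\in V$ let $N^-(v)=\{u\in V:(u,v)\in E\}$ and $k_t(v)=\sum_{u\in N^-(v)}x_t(u)$. All vertices are updated synchronously by: $x_{t+1}(v)=1$ if $k_t(v)$ is a prime number, and $x_{t+1}(v)=0$ otherwise. An attractor of period $p$ is a periodic sequence (periodic orbit) of this update consisting of $p$ distinct states; a fixed point is an attractor of period $1$. $L(n)$ denotes the maximum attractor period among all labeled directed loopless Pulse Graphs on $n$ vertices. *)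

(* Defs.v *)
From mathcomp Require Import all_boot.

Set Implicit Arguments.
Unset Strict Implicit.
Unset Printing Implicit Defensive.

(* A labeled digraph on n vertices is its edge set: (u, v) \in E is the edge
   u -> v. *)
Definition digraph (n : nat) := {set 'I_n * 'I_n}.

Definition loopless n (E : digraph n) : bool := [forall v, (v, v) \notin E].

Definition state (n : nat) := {ffun 'I_n -> bool}.

Definition in_nbhd n (E : digraph n) (v : 'I_n) : {set 'I_n} :=
  [set u | (u, v) \in E].

Definition active_in n (E : digraph n) (x : state n) (v : 'I_n) : nat :=
  \sum_(u in in_nbhd E v) x u.

Definition pulse n (E : digraph n) (x : state n) : state n :=
  [ffun v => prime (active_in E x v)].

(* c lists the p distinct states of a periodic orbit in order of visit, the
   last state being mapped back to the first. *)
Definition attractor n (E : digraph n) p (c : p.-tuple (state n)) : bool :=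
  [&& 0 < p, uniq c & fcycle (pulse E) c].

Definition has_attractor n (E : digraph n) (p : nat) : bool :=
  [exists c : p.-tuple (state n), attractor E c].

(* The range of p loses nothing, as a period never exceeds the number of
   states: see L_max and L_attained. *)
Definition L (n : nat) : nat :=
  \max_(E : digraph n | loopless E)
    \max_(p < #|{: state n}|.+1 | has_attractor E p) p.

Lemma L_max n (E : digraph n) p :
  loopless E -> has_attractor E p -> p <= L n.
Proof.
move=> llE Ep; have [c /and3P[_ c_uniq _]] := existsP Ep.
have ltp : p < #|{: state n}|.+1.
  by rewrite ltnS -(size_tuple c) -(card_uniqP c_uniq) max_card.
apply: leq_trans (leq_bigmax_cond _ llE).
exact: (leq_bigmax_cond (Ordinal ltp) Ep).
Qed.

Lemma L_attained n : exists2 E : digraph n, loopless E & has_attractor E (L n).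
Proof.
have ll0 : loopless (set0 : digraph n) by apply/forallP=> v; rewrite inE.
have fix0 : has_attractor (set0 : digraph n) 1.
  apply/existsP; exists [tuple [ffun=> false]]; rewrite /attractor /= andbT.
  apply/eqP/ffunP=> v; rewrite !ffunE /active_in big1 // => u _.
  by rewrite ffunE.
have L_gt0 : 0 < L n := L_max ll0 fix0.
rewrite /L in L_gt0 *.
have [|E llE eqE] := @eq_bigmax_cond _ [pred E | loopless E]
  (fun E : digraph n => \max_(p < #|{: state n}|.+1 | has_attractor E p) p).
  by apply/card_gt0P; exists set0.
rewrite eqE in L_gt0 *; exists E => //.
have [|p Ep ->] := @eq_bigmax_cond _
  [pred p : 'I_#|{: state n}|.+1 | has_attractor E p] (@nat_of_ord _) => //.
rewrite lt0n; apply: contraTneq L_gt0 => /card0_eq noE.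
by rewrite big1 // => p Ep; have := noE p; rewrite inE Ep.
Qed.

(* Main.v *)
Require Import Defs.
From mathcomp Require Import all_boot all_order all_algebra all_solvable all_field.
From mathcomp Require Import ring lra zify.

(** Put m = n - 4, an odd number at least 3. The graph is a shift register on
    m vertices, of period 2 ^ m - 1, attached to a clock on 4 vertices, of
    period 3.

    The clock always has exactly 3 active vertices: a directed 3-cycle carries
    a single inactive vertex around, and a fourth vertex stays active. Every
    register vertex receives the whole clock, so it computes [prime (3 + s)]
    where s counts its active inputs in the register. As 3 and 5 are prime and
    4 is not, for s <= 2 this is the negated parity of s: the register
    performs an affine map over F_2.

    Let alpha be a primitive element of F_{2^m}, with
    alpha ^ m = \sum_(i < m) a_i alpha ^ i, and read the register x as the
    field element \sum_i x_i alpha ^ i. Multiplication by alpha sends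
    coordinate u to coordinate u + 1, and the last coordinate to the v with
    a_v = 1. Each vertex thus has at most 2 inputs in the register, and the
    only possible loop is at the last vertex, present when a_(m-1) = 1. Up to
    a translation of F_{2^m}, which absorbs the constant of the affine map,
    the register multiplies by alpha, so all its states but one lie on a
    single cycle of length 2 ^ m - 1 ([exists_tap_orbit]). Since m is odd, 3
    does not divide 2 ^ m - 1, and the two periods multiply.

    The coefficient a_(m-1) is the trace of alpha, so what remains is a
    primitive alpha of trace 0 ([exists_primitive_trace0]). Put N = 2 ^ m - 1
    and psi(x) = (-1) ^ Tr(x). If every primitive element had trace 1, psi
    would sum to - totient N over them. Inclusion-exclusion over the w primes
    dividing N ([sieve_sqr_bound]) expresses that sum through 2 ^ w sums of
    psi over subgroups of the multiplicative group, and a second moment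
    computation ([subgroup_sum_bound]) bounds the square of each by N. Hence
    (totient N) ^ 2 <= 4 ^ w N. But the primes dividing N are at least 7
    ([prime_divisor_mersenne_ge7]), which forces
    5 ^ w N <= (totient N) ^ 2 ([leq_totient_sqr]): a contradiction. *)

Set Implicit Arguments.
Unset Strict Implicit.
Unset Printing Implicit Defensive.

Import Order.TTheory GRing.Theory Num.Theory.

(** * Prime divisors of 2 ^ m - 1 for odd m *)

(** An odd power of 2 is 0 modulo 2, 2 modulo 3, and 2 or 3 modulo 5: never 1. *)
Lemma prime_divisor_mersenne_ge7 m p :
  odd m -> prime p -> p %| 2 ^ m - 1 -> 7 <= p.
Proof.
move=> m_odd p_pr p_dvd.
have m_eq : m = m./2.*2.+1 by rewrite -{1}(odd_double_half m) m_odd.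
have pow_mod : 2 ^ m = 2 * 4 ^ m./2 by rewrite {1}m_eq expnS -mul2n expnM.
have pow_gt0 : 0 < 2 ^ m by rewrite expn_gt0.
have pow1 : 2 ^ m = 1 %[mod p] by apply/eqP; rewrite eqn_mod_dvd.
rewrite pow_mod in pow1; rewrite leqNgt; apply/negP=> p_lt7.
case: p p_lt7 p_pr pow1 {p_dvd} => [|[|[|[|[|[|[|p]]]]]]] // _ _.
- by rewrite modnMr.
- by rewrite -modnMmr -modnXm exp1n.
- have -> : m./2 = odd m./2 + 2 * (m./2)./2 by rewrite mul2n odd_double_half.
  rewrite expnD expnM mulnA -modnMmr -[_ ^ (_./2)./2 %% _]modnXm exp1n.
  by case: odd.
Qed.

(** Both sides are products over the primes dividing n, and for p >= 7 the
    local inequality 5 p ^ l <= ((p - 1) p ^ (l - 1)) ^ 2 holds, since it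
    reads 35 <= 36 for p = 7 and l = 1. *)
Lemma leq_totient_sqr n :
  0 < n -> (forall p, prime p -> p %| n -> 7 <= p) ->
  5 ^ size (primes n) * n <= totient n ^ 2.
Proof.
move=> n_gt0 p_ge7.
have n_prod : n = \prod_(p <- primes n) p ^ logn p n.
  by rewrite {1}[n]prod_prime_decomp // prime_decompE big_map.
have five_prod : 5 ^ size (primes n) = \prod_(p <- primes n) 5.
  by rewrite big_const_seq count_predT iter_muln_1.
rewrite totientE // {2}n_prod five_prod -big_split expnS expn1 -big_split /=.
rewrite !big_seq; apply: leq_prod => p; rewrite mem_primes => /and3P[p_pr _ pn].
have l_gt0 : 0 < logn p n by rewrite logn_gt0 mem_primes p_pr n_gt0.
have := p_ge7 p p_pr pn; case: p p_pr pn l_gt0 => // p _ _.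
case: (logn _ n) => // l _ /=; rewrite expnS => p_ge6.
have: 0 < p.+1 ^ l by rewrite expn_gt0.
move: (p.+1 ^ l) => q q_gt0.
have q1 : q <= q * q by rewrite leq_pmulr.
have p1 : 5 * p.+1 <= p * p by nia.
by rewrite mulnACA mulnA leq_mul.
Qed.

Lemma coprime_all_primes k N :
  0 < N -> coprime k N = all (fun p => ~~ (p %| k)) (primes N).
Proof.
move=> N_gt0; apply/idP/allP => [co p | no_p].
  rewrite mem_primes => /and3P[p_pr _ pN]; apply/negP=> pk.
  have : p %| gcdn k N by rewrite dvdn_gcd pk.
  by rewrite (eqP co) dvdn1 => /eqP p1; rewrite p1 in p_pr.
apply/eqP; case: (ltngtP (gcdn k N) 1) => // [|g_gt1].
  by rewrite ltnS leqn0 -[_ == _]negbK -lt0n gcdn_gt0 N_gt0 orbT.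
have := no_p (pdiv (gcdn k N)); rewrite mem_primes pdiv_prime // N_gt0.
by have := pdiv_dvd (gcdn k N); rewrite dvdn_gcd => /andP[-> ->] /(_ isT).
Qed.

Local Open Scope ring_scope.

(** * Sums of additive characters over subgroups *)

(** Sieving out a prime p replaces the sum over the multiples of d by a
    difference of two such sums, for d and d p; by
    (a - b) ^ 2 <= 2 (a ^ 2 + b ^ 2), this costs a factor 4 on squares. *)
Lemma sieve_sqr_bound N (f : nat -> int) (B : int) :
    (forall d, (d %| N)%N -> (\sum_(k < N | (d %| k)%N) f k) ^+ 2 <= B) ->
  forall ps d, uniq ps -> all prime ps -> all (dvdn^~ N) ps ->
    (d %| N)%N -> all (coprime d) ps ->
  (\sum_(k < N | (d %| k)%N && all (fun p => ~~ (p %| k)%N) ps) f k) ^+ 2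
    <= 4 ^+ size ps * B.
Proof.
move=> fB; elim=> [|p ps IHps] d /=.
  move=> _ _ _ dN _; rewrite expr0 mul1r.
  by rewrite (eq_bigl (fun k : 'I_N => d %| k)%N) ?fB // => k; rewrite andbT.
move=> /andP[p_ps ps_uniq] /andP[p_pr ps_pr] /andP[pN psN] dN /andP[dp dps].
set S := \sum_(k < N | _) _.
pose A e := \sum_(k < N | (e %| k)%N && all (fun p => ~~ (p %| k)%N) ps) f k.
have S_eq : S = A d - A (d * p)%N.
  rewrite [A d](bigID (fun k : 'I_N => p %| k)%N) /= [X in X - _]addrC.
  rewrite -addrA [X in _ + X](_ : _ = 0) ?addr0 /S.
    by apply: eq_bigl => k; rewrite -andbA [_ && all _ _]andbC.
  apply/eqP; rewrite subr_eq0; apply/eqP; apply: eq_bigl => k.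
  by rewrite Gauss_dvd // andbAC.
have Ad : A d ^+ 2 <= 4 ^+ size ps * B by apply: IHps.
have Adp : A (d * p)%N ^+ 2 <= 4 ^+ size ps * B.
  apply: IHps => //; first by rewrite Gauss_dvd ?dN.
  apply/allP=> q q_ps; rewrite coprimeMl (allP dps) //=.
  rewrite prime_coprime // dvdn_prime2 ?(allP ps_pr q q_ps) //.
  by apply: contraNneq p_ps => ->.
rewrite S_eq [4 ^+ _]exprS -mulrA.
move: (A d) (A _) (_ * B) Ad Adp => a b c; have := sqr_ge0 (a + b); nra.
Qed.

Lemma char_sum_eq0 (F : finFieldType) (psi : F -> int) :
    {morph psi : x y / x + y >-> x * y} -> (exists y, psi y != 1) ->
  forall a, a != 0 -> \sum_x psi (x * a) = 0.
Proof.
move=> psiD [y psiy] a a0.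
have -> : \sum_x psi (x * a) = \sum_x psi x.
  by rewrite [RHS](reindex_inj (mulIf a0)).
have : \sum_x psi x = psi y * \sum_x psi x.
  rewrite {1}(reindex_inj (addrI y)) mulr_sumr.
  by apply: eq_bigr => x _; rewrite psiD.
move/eqP; rewrite -subr_eq0 -{1}[X in X - _]mul1r -mulrBl mulf_eq0 subr_eq0.
by rewrite eq_sym (negPf psiy) => /eqP.
Qed.

(** Let S a be the sum of psi (a x) over x in C. By orthogonality the squares
    of all the S a add up to #|C| #|F|. This total contains #|C| ^ 2 from
    a = 0, and #|C| times the square of S 1 from the a in C, because C is
    stable under multiplication by its elements. *)
Lemma subgroup_sum_bound (F : finFieldType) (psi : F -> int) (C : {set F}) :
    2 \in [pchar F] -> {morph psi : x y / x + y >-> x * y} -> psi 0 = 1 ->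
    (exists y, psi y != 1) ->
    0 \notin C -> {in C &, forall x y, x * y \in C} ->
  #|C|%:R + (\sum_(x in C) psi x) ^+ 2 <= #|F|%:R.
Proof.
move=> F2 psiD psi0 psi_nt C0 CM.
pose S a := \sum_(x in C) psi (a * x).
have S0 : S 0 = #|C|%:R.
  rewrite /S (eq_bigr (fun=> 1)) ?sumr_const //.
  by move=> x _; rewrite mul0r.
have S_C : {in C, forall c, S c = \sum_(x in C) psi x}.
  move=> c cC; have c0 : c != 0 by apply: contraNneq C0 => <-.
  have cI := mulfI c0.
  have imC : [set c * x | x in C] = C.
    apply/eqP; rewrite eqEcard card_imset // leqnn andbT.
    by apply/subsetP=> _ /imsetP[x xC ->]; apply: CM.
  by rewrite -[in RHS]imC big_imset //=; apply: in2W.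
have S_all : \sum_a S a ^+ 2 = #|C|%:R * #|F|%:R.
  have -> : \sum_a S a ^+ 2 = \sum_(x in C) \sum_(y in C) \sum_a psi (a * (x + y)).
    transitivity (\sum_a \sum_(x in C) \sum_(y in C) psi (a * (x + y))).
      apply: eq_bigr => a _; rewrite expr2 big_distrlr; apply: eq_bigr => x _.
      by apply: eq_bigr => y _; rewrite mulrDr psiD.
    rewrite exchange_big; apply: eq_bigr => x _; exact: exchange_big.
  rewrite mulr_natl -sumr_const.
  apply: eq_bigr => x xC; rewrite (bigD1 x) //= [X in _ + X]big1 ?addr0; last first.
    move=> y /andP[_ yx]; apply: char_sum_eq0 => //.
    by rewrite addr_eq0 oppr_pchar2 // eq_sym.
  rewrite addrr_pchar2 // (eq_bigr (fun=> 1)) ?sumr_const ?cardT //.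
  by move=> a _; rewrite mulr0.
have [-> | [c cC]] := set_0Vmem C.
  by rewrite cards0 big_set0 expr0n /= addr0 ler0n.
have C_gt0 : 0 < #|C|%:R :> int by rewrite ltr0n; apply/card_gt0P; exists c.
rewrite -(ler_pM2l C_gt0) -S_all [X in _ <= X](bigD1 0) //= S0 mulrDr expr2 lerD2l.
rewrite [X in _ <= X](bigID [in C]) /= [X in _ <= X + _](eq_bigl [in C]); last first.
  by move=> a /=; rewrite andb_idl // => aC; apply: contraNneq C0 => <-.
rewrite [X in _ <= X + _](eq_bigr (fun=> (\sum_(x in C) psi x) ^+ 2)); last first.
  by move=> a aC; rewrite S_C.
by rewrite sumr_const mulr_natl lerDl sumr_ge0 // => a _; rewrite sqr_ge0.
Qed.

(** * The trace and the conjugates of an element of F_{2^m} *)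

Definition ftrace (F : finFieldType) m (x : F) : F := \sum_(i < m) x ^+ (2 ^ i).

Lemma idempotent_bool (R : idomainType) (x : R) : x ^+ 2 = x -> x = (x != 0)%:R.
Proof.
move/eqP; rewrite expr2 -subr_eq0 -{3}[x]mulr1 -mulrBr mulf_eq0 subr_eq0.
by case: eqP => [-> // | _ /eqP].
Qed.

(** Squaring permutes cyclically the m conjugates x ^ (2 ^ i), because
    x ^ (2 ^ m) = x. *)
Lemma big_conjugates_shift (F : finFieldType) m (R : Type) (idx : R)
    (op : Monoid.com_law idx) (G : F -> R) (x : F) :
  #|F| = (2 ^ m)%N ->
  \big[op/idx]_(i < m) G (x ^+ (2 ^ i) ^+ 2) = \big[op/idx]_(i < m) G (x ^+ (2 ^ i)).
Proof.
case: m => [|m] F_card; first by rewrite !big_ord0.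
rewrite [RHS]big_ord_recl big_ord_recr Monoid.mulmC /= -exprM -expnSr.
rewrite -F_card expf_card expr1; congr (op _ _); apply: eq_bigr => i _.
by rewrite -exprM -expnSr.
Qed.

Lemma ftraceD (F : finFieldType) m :
  2 \in [pchar F] -> {morph ftrace m : x y / (x : F) + y}.
Proof.
move=> F2 x y; rewrite -big_split; apply: eq_bigr => i _ /=.
by rewrite exprDn_pchar // pnatX pnatE ?F2.
Qed.

Lemma ftrace_bool (F : finFieldType) m (x : F) :
  2 \in [pchar F] -> #|F| = (2 ^ m)%N -> ftrace m x = (ftrace m x != 0)%:R.
Proof.
move=> F2 F_card; apply: idempotent_bool.
rewrite -(pFrobenius_autE F2) raddf_sum.
exact: (big_conjugates_shift _ id).
Qed.

Lemma ftrace1 (F : finFieldType) m :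
  2 \in [pchar F] -> odd m -> ftrace m 1 = 1 :> F.
Proof.
move=> F2 m_odd; rewrite /ftrace (eq_bigr (fun=> 1)) => [|i _]; last exact: expr1n.
by rewrite sumr_const card_ord -[m]odd_double_half m_odd mulrnDr -muln2 mulrnA mulr2n
  addrr_pchar2 // addr0.
Qed.

Lemma exists_primitive_trace0 (F : finFieldType) m :
    2 \in [pchar F] -> #|F| = (2 ^ m)%N -> odd m -> (1 < m)%N ->
  exists2 alpha : F, (2 ^ m - 1).-primitive_root alpha & ftrace m alpha = 0.
Proof.
move=> F2 F_card m_odd m_gt1; set N := (2 ^ m - 1)%N.
have N_gt1 : (1 < N)%N.
  by rewrite /N ltn_subRL (@leq_trans (2 ^ 2)) // leq_exp2l.
have N_gt0 := ltnW N_gt1.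
have F_cardN : #|F| = N.+1 by rewrite F_card /N subn1 prednK // expn_gt0.
have [g g_prim] : exists g : F, N.-primitive_root g.
  have /hasP[g _ g_prim] : has N.-primitive_root (enum (predC1 (0 : F))).
    apply: has_prim_root; rewrite ?enum_uniq //; last first.
      by rewrite -cardE cardC1 F_cardN.
    apply/allP=> x; rewrite mem_enum inE => x0; apply/unity_rootP.
    by apply: (mulfI x0); rewrite mulr1 -exprS -F_cardN expf_card.
  by exists g.
case: (boolP [exists k : 'I_N, coprime k N && (ftrace m (g ^+ k) == 0)]).
  case/existsP=> k /andP[kN /eqP tr0]; exists (g ^+ k) => //.
  by rewrite (prim_root_exp_coprime _ g_prim).
(* Otherwise all primitive elements have trace 1. *)
rewrite negb_exists => /forallP tr1.
pose psi (x : F) : int := (-1) ^+ (ftrace m x != 0)%R.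
have psiD : {morph psi : x y / x + y >-> x * y}.
  move=> x y; rewrite /psi ftraceD //.
  have:= ftrace_bool y F2 F_card; have:= ftrace_bool x F2 F_card.
  case: (ftrace m x != 0); case: (ftrace m y != 0) => -> ->;
  by rewrite ?addr0 ?add0r ?addrr_pchar2 ?eqxx ?oner_eq0.
have psi0 : psi 0 = 1.
  by rewrite /psi /ftrace big1 ?eqxx // => i _; rewrite expr0n expn_eq0.
have psi1 : exists y, psi y != 1.
  by exists 1; rewrite /psi ftrace1 // oner_eq0.
pose f k := psi (g ^+ k).
have f_bound d : (d %| N)%N -> (\sum_(k < N | (d %| k)%N) f k) ^+ 2 <= N%:R.
  (* The powers g ^ k with d | k form the subgroup of index d. *)
  move=> dN; pose h (k : 'I_N) := g ^+ k.
  have h_inj : injective h.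
    move=> i j /eqP; rewrite (eq_prim_root_expr g_prim) !modn_small // => /eqP.
    exact: val_inj.
  pose C := [set h k | k in [set k : 'I_N | (d %| k)%N]].
  have C0 : 0 \notin C.
    apply/imsetP=> -[k _ /esym/eqP]; rewrite expf_eq0 => /andP[_ /eqP g0].
    by have /eqP := prim_expr_order g_prim; rewrite g0 expr0n eqn0Ngt N_gt0
      eq_sym oner_eq0.
  have CM : {in C &, forall x y, x * y \in C}.
    move=> _ _ /imsetP[i + ->] /imsetP[j + ->]; rewrite !inE => di dj.
    apply/imsetP; exists (Ordinal (ltn_pmod (i + j) N_gt0)).
      by rewrite inE /= /dvdn modn_dvdm // -/(dvdn d _) dvdn_add.
    by rewrite /h /= -exprD prim_expr_mod.
  have := subgroup_sum_bound F2 psiD psi0 psi1 C0 CM.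
  rewrite big_imset /=; last exact: in2W.
  rewrite (eq_bigl (fun k : 'I_N => d %| k)%N) => [|k]; last by rewrite inE.
  have C_ge1 : 1 <= #|C|%:R :> int.
    rewrite ler1n; apply/card_gt0P; exists (h (Ordinal N_gt0)).
    by apply: imset_f; rewrite inE dvdn0.
  by rewrite F_cardN -natr1; lra.
have coprime_all (k : 'I_N) :
    coprime k N = (1 %| k)%N && all (fun p => ~~ (p %| k)%N) (primes N).
  by rewrite dvd1n coprime_all_primes.
have := @sieve_sqr_bound N f N%:R f_bound (primes N) 1
  (primes_uniq N) (all_prime_primes N).
rewrite -(eq_bigl _ _ coprime_all) (eq_bigr (fun=> -1)) => [|k kN]; last first.
  by have := tr1 k; rewrite kN /f /psi /= => ->.
have -> : \sum_(k < N | coprime k N) -1 = - (totient N)%:R :> int.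
  rewrite totient_count_coprime big_mkord natr_sum -sumrN big_mkcond.
  by apply: eq_bigr => k _; rewrite coprime_sym; case: coprime.
rewrite sqrrN => bound.
have {}bound : (totient N ^ 2 <= 4 ^ size (primes N) * N)%N.
  rewrite -(ler_nat int) natrX natrM natrX; apply: bound; rewrite ?dvd1n //.
    by apply/allP=> p; rewrite mem_primes => /and3P[].
  by apply/allP=> p _; rewrite coprime1n.
have p_ge7 p : prime p -> (p %| N)%N -> (7 <= p)%N.
  exact: prime_divisor_mersenne_ge7.
(* 5 ^ w <= 4 ^ w is impossible, as w > 0 *)
have := leq_trans (leq_totient_sqr N_gt0 p_ge7) bound.
rewrite leq_pmul2r // leqNgt ltn_exp2r //.
by rewrite lt0n size_eq0 primes_eq0 -leqNgt.
Qed.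

Lemma conjugates_uniq (R : nzRingType) m (alpha : R) :
    (1 < m)%N -> (2 ^ m - 1).-primitive_root alpha ->
  uniq [seq alpha ^+ (2 ^ i) | i <- iota 0 m].
Proof.
move=> m_gt1 alpha_prim; apply/mkseq_uniqP=> i j; rewrite !inE => im jm /eqP.
have pow_lt k : (k < m)%N -> (2 ^ k < 2 ^ m - 1)%N.
  move=> k_lt; rewrite ltn_subRL add1n; case: k k_lt => [|k] k_lt.
    by rewrite (@leq_trans (2 ^ 2)) ?leq_exp2l.
  have: (2 ^ k.+2 <= 2 ^ m)%N by rewrite leq_exp2l.
  have pow_gt0 : (0 < 2 ^ k)%N by rewrite expn_gt0.
  by rewrite !expnS; lia.
rewrite (eq_prim_root_expr alpha_prim) !modn_small ?pow_lt // eqn_exp2l //.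
by move/eqP.
Qed.

Lemma root_conjugates (F : finFieldType) (alpha : F) (p : {poly F}) :
    2 \in [pchar F] -> (forall i, p`_i ^+ 2 = p`_i) -> root p alpha ->
  forall i, root p (alpha ^+ (2 ^ i)).
Proof.
move=> F2 p_bool p_root; elim=> [|i IHi]; first by rewrite expr1.
have p_frob : map_poly (pFrobenius_aut F2) p = p.
  by apply/polyP=> k; rewrite coef_map /= pFrobenius_autE p_bool.
have := rmorph_root (pFrobenius_aut F2) IHi.
by rewrite p_frob /= pFrobenius_autE -exprM -expnSr.
Qed.

(** A relation between the first m powers of alpha with coefficients in F_2 is
    a polynomial of size at most m, which then has the m conjugates of alpha as
    roots. The coefficients in F_2 are described as the solutions of
    x ^ 2 = x in F. *)
Lemma powers_free (F : finFieldType) m (alpha : F) (c : 'I_m -> F) :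
    2 \in [pchar F] -> (1 < m)%N -> (2 ^ m - 1).-primitive_root alpha ->
    (forall i, c i ^+ 2 = c i) -> \sum_(i < m) c i * alpha ^+ i = 0 ->
  forall i, c i = 0.
Proof.
move=> F2 m_gt1 alpha_prim c_bool c_dep i0.
pose p := \poly_(i < m) c (insubd i0 i).
have p_eq (i : 'I_m) : p`_i = c i by rewrite coef_poly ltn_ord valKd.
have p_bool i : p`_i ^+ 2 = p`_i.
  by rewrite coef_poly; case: ltnP => // _; rewrite expr0n.
have p_root : root p alpha.
  rewrite rootE horner_poly (eq_bigr (fun i : 'I_m => c i * alpha ^+ i)) ?c_dep //.
  by move=> i _; rewrite valKd.
rewrite -p_eq; suff -> : p = 0 by rewrite coef0.
apply/eqP; apply: contraTT (size_poly m (fun i => c (insubd i0 i))) => p_neq0.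
rewrite -ltnNge; have := max_poly_roots p_neq0 _ (conjugates_uniq m_gt1 alpha_prim).
rewrite size_map size_iota; apply.
by apply/allP=> _ /mapP[i _ ->]; apply: root_conjugates.
Qed.

(** The polynomial whose roots are the conjugates of alpha, with multiplicity,
    is fixed by the Frobenius automorphism, hence has coefficients in F_2; its
    coefficient of degree m - 1 is minus the trace. *)
Lemma pow_dim_trace0 (F : finFieldType) m (alpha : F) :
    2 \in [pchar F] -> #|F| = (2 ^ m)%N -> (0 < m)%N -> ftrace m alpha = 0 ->
  exists2 a : nat -> bool, ~~ a m.-1 &
    alpha ^+ m = \sum_(i < m) (a i)%:R * alpha ^+ i.
Proof.
move=> F2 F_card m_gt0 tr0.
pose h (i : 'I_m) := alpha ^+ (2 ^ i).
pose p := \prod_(i < m) ('X - (h i)%:P).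
have p_seq : p = \prod_(x <- [seq h i | i <- enum 'I_m]) ('X - x%:P).
  by rewrite big_map big_enum.
have p_frob : map_poly (pFrobenius_aut F2) p = p.
  rewrite map_prod_XsubC.
  exact: (big_conjugates_shift _ (fun y : F => 'X - y%:P)).
have p_bool i : p`_i = (p`_i != 0)%:R.
  by apply: idempotent_bool; rewrite -(pFrobenius_autE F2) -coef_map p_frob.
have p_size : size p = m.+1.
  by rewrite p_seq size_prod_XsubC size_map size_enum_ord.
have p_lead : p`_m = 1.
  have /monicP := monic_prod_XsubC (index_enum 'I_m) xpredT h.
  by rewrite -/p lead_coefE p_size.
exists (fun i => p`_i != 0).
  rewrite negbK p_seq.
  have s_size : size [seq h i | i <- enum 'I_m] = m by rewrite size_map size_enum_ord.
  have := coefPn_prod_XsubC (ps := [seq h i | i <- enum 'I_m]).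
  rewrite s_size -lt0n => ->; rewrite ?m_gt0 //.
  by rewrite big_map big_enum -[X in - X]/(ftrace m alpha) tr0 oppr0.
have : root p alpha.
  rewrite /root horner_prod (bigD1 (Ordinal m_gt0)) //= !hornerE.
  by rewrite /h expr1 subrr mul0r.
rewrite rootE horner_coef p_size big_ord_recr /= p_lead mul1r addrC addr_eq0.
rewrite oppr_pchar2 // => /eqP ->; apply: eq_bigr => i _.
by rewrite -p_bool.
Qed.

(** * The shift register *)

(** The edges u -> v are the nonzero coordinates v of alpha ^ u.+1 over the
    first m powers of alpha, when a lists the coordinates of alpha ^ m. *)
Definition tap_edge m (a : nat -> bool) (u v : 'I_m) : bool :=
  if (u.+1 < m)%N then v == u.+1 :> nat else a v.

(** The constant 3 is the input that each vertex receives from the clock. *)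
Definition tap_step m (a : nat -> bool) (x : state m) : state m :=
  [ffun v => prime (3 + \sum_u tap_edge a u v * x u)].

(** A vertex v is entered only from v - 1 and from the last vertex. *)
Lemma tap_weight m (a : nat -> bool) (x : state m) v :
  (\sum_u tap_edge a u v * x u <= 2)%N.
Proof.
apply: (@leq_trans (\sum_u tap_edge a u v)).
  by apply: leq_sum => u _; case: (x u); rewrite ?muln1 ?muln0.
case: m x v => [|m] _ v; first by rewrite big_ord0.
rewrite big_ord_recr -[2%N]/(1 + 1)%N; apply: leq_add => /=; last by case: tap_edge.
rewrite (eq_bigr (fun u : 'I_m => if v == u.+1 :> nat then 1 else 0)%N); last first.
  by move=> u _; rewrite /tap_edge /= ltnS ltn_ord; case: eqP.
rewrite -big_mkcond sum1_card; apply/card_le1_eqP => u w /eqP vu /eqP vw.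
by apply: val_inj; apply: succn_inj; rewrite -vu.
Qed.

Lemma natr_pchar2 (R : nzRingType) k : 2 \in [pchar R] -> k%:R = (odd k)%:R :> R.
Proof.
move=> R2; rewrite -{1}[k]odd_double_half natrD -mul2n natrM.
by rewrite (pcharf0 R2) mul0r addr0.
Qed.

(** Among 3, ..., 8 the primes are the odd numbers; 9 breaks the pattern. *)
Lemma prime_xnor (R : nzRingType) k : 2 \in [pchar R] ->
  (k <= 5)%N -> (prime (3 + k))%:R = 1 + k%:R :> R.
Proof.
move=> R2 k_le5; have -> : prime (3 + k) = ~~ odd k.
  by case: k k_le5 => [|[|[|[|[|[|]]]]]].
rewrite [k%:R]natr_pchar2 //; case: (odd k) => /=; last by rewrite addr0.
by rewrite addrr_pchar2.
Qed.

(** On coordinates over the powers of alpha, which determine the state because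
    these powers are independent, the step is the map
    y |-> alpha * y + w, where w is the element with all coordinates 1. *)
Lemma tap_step_conj (F : finFieldType) m (a : nat -> bool) (alpha : F) :
    2 \in [pchar F] -> alpha != 1 ->
    alpha ^+ m = \sum_(i < m) (a i)%:R * alpha ^+ i ->
    (forall c : 'I_m -> F, (forall i, c i ^+ 2 = c i) ->
       \sum_(i < m) c i * alpha ^+ i = 0 -> forall i, c i = 0) ->
  exists2 E : state m -> F, injective E &
    forall x, E (tap_step a x) = alpha * E x.
Proof.
move=> F2 alpha1 alpha_m free.
pose w := \sum_(v < m) alpha ^+ v.
(* The translation by w / (alpha - 1) conjugates y |-> alpha * y + w to the
   multiplication by alpha. *)
exists (fun x : state m => \sum_v (x v)%:R * alpha ^+ v + w / (alpha - 1))
  => [x y /addIr xy|x].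
  apply/ffunP=> v.
  have: (x v)%:R - (y v)%:R = 0 :> F.
    apply: (free (fun u => (x u)%:R - (y u)%:R)) v => [u|].
      by case: (x u); case: (y u); rewrite ?subrr ?sub0r ?subr0 ?sqrrN
        ?expr0n ?expr1n ?oppr_pchar2.
    apply/eqP; under eq_bigr do rewrite mulrBl.
    by rewrite sumrB subr_eq0 xy.
  case: (x v); case: (y v) => // /eqP; rewrite ?sub0r ?subr0 ?oppr_eq0 oner_eq0 //.
have step_v v : (tap_step a x v)%:R = 1 + \sum_u (tap_edge a u v)%:R * (x u)%:R :> F.
  rewrite ffunE prime_xnor //; last exact: leq_trans (tap_weight a x v) _.
  by rewrite natr_sum; congr (_ + _); apply: eq_bigr => u _; rewrite natrM.
have edge_u (u : 'I_m) : \sum_v (tap_edge a u v)%:R * alpha ^+ v = alpha ^+ u.+1.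
  rewrite /tap_edge; case: ltnP => um.
    rewrite (bigD1 (Ordinal um)) //= eqxx mul1r big1 ?addr0 // => v.
    by rewrite -val_eqE /= => /negPf ->; rewrite mul0r.
  by have -> : u.+1 = m by apply/eqP; rewrite eqn_leq um ltn_ord.
under eq_bigr => v _ do rewrite step_v mulrDl mul1r mulr_suml.
rewrite big_split /= -/w exchange_big /=.
rewrite (eq_bigr (fun u : 'I_m => alpha * ((x u)%:R * alpha ^+ u))); last first.
  move=> u _; under eq_bigr => v _ do rewrite -mulrA mulrCA.
  by rewrite -mulr_sumr edge_u exprS mulrCA.
rewrite -mulr_sumr; set e := \sum_(u < m) _.
by field; rewrite subr_eq0.
Qed.

(** Under multiplication by alpha every nonzero element of the field has the
    multiplicative order of alpha as its period. *)
Lemma exists_tap_orbit m : odd m -> (1 < m)%N ->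
  exists2 a : nat -> bool, ~~ a m.-1 & exists x : state m, forall i j,
    (iter i (tap_step a) x == iter j (tap_step a) x) = (i == j %[mod 2 ^ m - 1]).
Proof.
move=> m_odd m_gt1.
have [F F2 F_card] := @pPrimePowerField 2 m isT (ltnW m_gt1).
have [alpha alpha_prim tr0] := exists_primitive_trace0 F2 F_card m_odd m_gt1.
have [a a_last alpha_m] := pow_dim_trace0 F2 F_card (ltnW m_gt1) tr0.
have alpha1 : alpha != 1.
  rewrite -[alpha]expr1 -(prim_order_dvd alpha_prim) dvdn1 neq_ltn orbC.
  by rewrite ltn_subRL (@leq_trans (2 ^ 2)) // leq_exp2l.
have [E E_inj E_step] := tap_step_conj F2 alpha1 alpha_m
  (fun c => powers_free F2 m_gt1 alpha_prim).
exists a => //.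
have E_iter i x : E (iter i (tap_step a) x) = alpha ^+ i * E x.
  by elim: i => [|i IHi] /=; rewrite ?mul1r // E_step IHi exprS mulrA.
have [x Ex] : exists x, E x != 0.
  pose x0 : state m := [ffun=> false]; pose x1 : state m := [ffun=> true].
  have [E0|] := eqVneq (E x0) 0; last by exists x0.
  exists x1; rewrite -E0 (inj_eq E_inj); apply/eqP=> /ffunP/(_ (Ordinal (ltnW m_gt1))).
  by rewrite !ffunE.
exists x => i j; rewrite -(inj_eq E_inj) !E_iter (inj_eq (mulIf Ex)).
by rewrite (eq_prim_root_expr alpha_prim).
Qed.

Local Close Scope ring_scope.

(** * The clock, and the graph *)

Lemma fcycle_traject (T : eqType) (f : T -> T) p s :
  iter p f s = s -> fcycle f (traject f s p).
Proof.
case: p => // p iter_p; rewrite /= -[X in rcons _ X]iter_p iterSr -trajectSr.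
exact: fpath_traject.
Qed.

Lemma has_attractor_iter n (E : digraph n) p (s : state n) :
    0 < p ->
    (forall i j, (iter i (pulse E) s == iter j (pulse E) s) = (i == j %[mod p])) ->
  has_attractor E p.
Proof.
rewrite /has_attractor /attractor; move: (pulse E) => f.
case: p => // p _ s_iter; apply/existsP.
exists (Tuple (introT eqP (size_traject f s p.+1))).
have iter_p : iter p.+1 f s = s.
  by apply/eqP; rewrite (s_iter p.+1 0) modnn mod0n.
apply/and3P; split=> //.
  rewrite looping_uniq; apply/negP=> /trajectP[i ip /eqP].
  have i_le : i < p.+1 by apply: ltnW.
  by rewrite s_iter (modn_small (ltnSn p)) (modn_small i_le) gtn_eqF.
exact: fcycle_traject iter_p.
Qed.

(** The vertices 0, 1, 2 form a directed 3-cycle, and vertex 3 is joined to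
    each of them in both directions. Vertex 3 has 2 active inputs at all times;
    a vertex of the 3-cycle copies its predecessor on it, because one more
    active input turns the counts 0 and 1 into 1 and 2. *)
Definition clock_edge (i j : 'I_4) : bool :=
  (i != j) && [|| i == 3 :> nat, j == 3 :> nat | j == i.+1 %% 3 :> nat].

Definition clock t (j : 'I_4) : bool := j != t %% 3 :> nat.

Lemma clock_weight t : \sum_j clock t j = 3.
Proof.
rewrite !big_ord_recr big_ord0 /clock /=.
by case: (t %% 3) (ltn_pmod t (isT : 0 < 3)) => [|[|[|]]].
Qed.

Lemma clock_step t j : prime (\sum_i clock_edge i j * clock t i) = clock t.+1 j.
Proof.
rewrite /clock -[t.+1]addn1 -modnDml.
case: (t %% 3) (ltn_pmod t (isT : 0 < 3)) => [|[|[|]]] // _;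
by rewrite !big_ord_recr big_ord0 /clock_edge; case: j => -[|[|[|[|]]]].
Qed.

Lemma split_lshift m n (i : 'I_m) : split (lshift n i) = inl i.
Proof. exact: (unsplitK (inl i)). Qed.

Lemma split_rshift m n (i : 'I_n) : split (rshift m i) = inr i.
Proof. exact: (unsplitK (inr i)). Qed.

Definition register_edge m (a : nat -> bool) (u v : 'I_m + 'I_4) : bool :=
  match u, v with
  | inl u, inl v => tap_edge a u v
  | inl _, inr _ => false
  | inr _, inl _ => true
  | inr i, inr j => clock_edge i j
  end.

Definition register m a : digraph (m + 4) :=
  [set e | register_edge a (split e.1) (split e.2)].

Definition register_state m (x : state m) t : state (m + 4) :=
  [ffun v => match split v with inl v => x v | inr j => clock t j end].

(** A register vertex sees the 3 active clock vertices besides its register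
    inputs, and the clock sees only itself. *)
Lemma pulse_register m a (x : state m) t :
  pulse (register m a) (register_state x t) = register_state (tap_step a x) t.+1.
Proof.
apply/ffunP=> v; rewrite !ffunE.
have -> : active_in (register m a) (register_state x t) v =
    \sum_u register_edge a (inl u) (split v) * x u +
    \sum_i register_edge a (inr i) (split v) * clock t i.
  rewrite /active_in big_mkcond big_split_ord /=; congr (_ + _);
  apply: eq_bigr => u _; rewrite !inE ffunE /=.
    rewrite split_lshift; case: (split v) => [w|j] //=.
    by case: tap_edge; rewrite ?mul1n.
  rewrite split_rshift; case: (split v) => [w|j] /=; rewrite ?mul1n //.
  by case: clock_edge; rewrite ?mul1n.
case: (split v) => [w|j] /=.
  by under [X in _ + X]eq_bigr do rewrite mul1n; rewrite clock_weight addnC ffunE.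
by rewrite big1 // clock_step.
Qed.

Lemma register_loopless m a : ~~ a m.-1 -> loopless (register m a).
Proof.
move=> a_last; apply/forallP=> v; rewrite inE /=.
case: (split v) => [u|i] /=; last by rewrite /clock_edge eqxx.
rewrite /tap_edge; case: ltnP => um; first by rewrite neq_ltn ltnSn.
by have -> : u = m.-1 :> nat by have := ltn_ord u; lia.
Qed.

Lemma clock_inj i j : (forall k, clock i k = clock j k) -> i = j %[mod 3].
Proof.
move=> ij; apply/eqP; rewrite -[_ == _]negbK.
have i4 : i %% 3 < 4 by apply: leq_trans (ltn_pmod _ _) _.
by rewrite -/(clock j (Ordinal i4)) -ij /clock eqxx.
Qed.

Theorem corollary10 (n : nat) (n_odd : odd n) (n_ge7 : 7 <= n) :
  3 * (2 ^ (n - 4) - 1) <= L n.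
Proof.
have [m n_eq] : exists m, n = m + 4 by exists (n - 4); lia.
rewrite n_eq oddD addbF addnK in n_odd n_ge7 *.
have m_gt1 : 1 < m by lia.
have [a a_last [x x_iter]] := exists_tap_orbit n_odd m_gt1.
have iter_register t : iter t (pulse (register m a)) (register_state x 0) =
    register_state (iter t (tap_step a) x) t.
  by elim: t => //= t ->; rewrite pulse_register.
apply: L_max (register_loopless a_last)
  (has_attractor_iter (s := register_state x 0) _ _).
  by rewrite muln_gt0 /= subn_gt0 -{1}(expn0 2) ltn_exp2l // ltnW.
move=> i j; rewrite chinese_remainder; last first.
  rewrite prime_coprime //; apply/negP=> d3.
  by have := prime_divisor_mersenne_ge7 n_odd (isT : prime 3) d3.
rewrite !iter_register -x_iter; apply/eqP/andP => [/ffunP eq_ij | [/eqP ij /eqP ->]].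
  split; last first.
    apply/eqP/ffunP=> v; have := eq_ij (lshift 4 v).
    by rewrite !ffunE split_lshift.
  apply/eqP/clock_inj => k; have := eq_ij (rshift m k).
  by rewrite !ffunE split_rshift.
apply/ffunP=> v; rewrite !ffunE; case: split => // k.
by rewrite /clock ij.
Qed.
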